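(* Let $G=(V,A)$ be a digraph with arc costs $c_a\in\mathbb{R}^d_{\ge0}$, $s,t\in V$ with $t$ reachable from $s$, $\Sigma$ a set of preprocessing orders, and $\varepsilon>0$. Define $$\beta_t:=\Big(\max_{\sigma\in\Sigma}c_1(T_\sigma(s))+\varepsilon,\ \dots,\ \max_{\sigma\in\Sigma}c_d(T_\sigma(s))+\varepsilon\Big).$$ Then $\beta_t$ is a dominance bound, i.e., there is no efficient $s$-$t$-path $p$ with $\beta_t\le c(p)$ (componentwise).
   Context: $c(p)=\sum_{a\in p}c_a$ for a path $p$. An $s$-$t$-path $p$ is efficient if there is no $s$-$t$-path $q$ with $c(q)\le c(p)$ componentwise and $c_j(q)<c_j(p)$ for some $j$. A set of preprocessing orders is a set $\Sigma$ of $d$ permutations of $(1,\dots,d)$ such that for every $i\in\{1,\dots,d\}$ exactly one $\sigma\in\Sigma$ has $\sigma_1=i$. For $\sigma\in\Sigma$, $T_\sigma(s)$ is the $s$-$t$-path found by a $t$-to-all $\sigma$-lexicographic Dijkstra query (Dijkstra's algorithm on the reversed digraph from $t$, comparing path costs lexicographically in the coordinate order $(c_{\sigma_1},\dots,c_{\sigma_d})$); it is an $s$-$t$-path in $G$ that is lexicographically minimal w.r.t. that order. A dominance bound is a vector $\beta\in\mathbb{R}^d$ such that no efficient $s$-$t$-path $p$ satisfies $\beta\le c(p)$. *)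

(* Defs.v *)
From HB Require Import structures.
From mathcomp Require Import all_boot all_order all_algebra all_fingroup.
From mathcomp Require Import reals.
Set Implicit Arguments.
Unset Strict Implicit.
Unset Printing Implicit Defensive.
Import Order.TTheory GRing.Theory Num.Theory.
Local Open Scope ring_scope.

(* A digraph on the finite vertex type V is its set A of arcs; the arc (u, v)
   goes from u to v. A path is the sequence of its arcs and visits no vertex
   twice; the empty sequence is the path from a vertex to itself. *)
Definition st_path (V : finType) (A : {set V * V}) (s t : V)
    (p : seq (V * V)) : bool :=
  [&& all (fun a => a \in A) p,
      unzip1 p == belast s (unzip2 p),
      last s (unzip2 p) == t
    & uniq (s :: unzip2 p)].

Definition cost (R : realType) (d : nat) (V : finType) (c : V * V -> 'rV[R]_d)
    (p : seq (V * V)) : 'rV[R]_d :=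
  \sum_(a <- p) c a.

Definition efficient (R : realType) (d : nat) (V : finType) (A : {set V * V})
    (c : V * V -> 'rV[R]_d) (s t : V) (p : seq (V * V)) : Prop :=
  st_path A s t p /\
  ~ exists q, [/\ st_path A s t q,
                  forall i, cost c q 0 i <= cost c p 0 i
                & exists j, cost c q 0 j < cost c p 0 j].

Definition dominance_bound (R : realType) (d : nat) (V : finType)
    (A : {set V * V}) (c : V * V -> 'rV[R]_d) (s t : V) (beta : 'rV[R]_d) :
    Prop :=
  ~ exists p, efficient A c s t p /\ forall i, beta 0 i <= cost c p 0 i.

(* Coordinates are numbered from 0, so the first entry of the order sigma is
   the value of sigma at Ordinal d_gt0 : 'I_d. *)
Definition preprocessing_orders (d : nat) (d_gt0 : (0 < d)%N)
    (Sigma : {set 'S_d}) : Prop :=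
  #|Sigma| = d /\
  forall i : 'I_d,
    exists! sigma : 'S_d, sigma \in Sigma /\ sigma (Ordinal d_gt0) = i.

(* The type n.-tuplelexi R is n.-tuple R ordered lexicographically. *)
Definition lex_key (R : realType) (d : nat) (sigma : 'S_d) (x : 'rV[R]_d) :
    d.-tuplelexi R :=
  [tuple x 0 (sigma i) | i < d].

(* Dijkstra's algorithm on the reversed digraph, started at t. The label of v
   is the current tentative path, stored as a v-t-path of the original digraph
   (None while v has not been reached); D is the set of permanently labelled
   vertices. *)
Definition labelling (V : finType) := {ffun V -> option (seq (V * V))}.

Definition init_labels (V : finType) (t : V) : labelling V :=
  [ffun v => if v == t then Some [::] else None].

Definition lex_improves (R : realType) (d : nat) (V : finType)
    (c : V * V -> 'rV[R]_d) (sigma : 'S_d) (p : seq (V * V))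
    (q : option (seq (V * V))) : bool :=
  if q is Some q' then
    (lex_key sigma (cost c p) < lex_key sigma (cost c q'))%O
  else true.

(* Every arc (u, v), reversed, extends the path p at v to the candidate
   (u, v) :: p at u. *)
Definition relax (R : realType) (d : nat) (V : finType) (A : {set V * V})
    (c : V * V -> 'rV[R]_d) (sigma : 'S_d) (D : {set V}) (l : labelling V)
    (v : V) (p : seq (V * V)) : labelling V :=
  [ffun u => if [&& u \notin D, (u, v) \in A
                  & lex_improves c sigma ((u, v) :: p) (l u)]
             then Some ((u, v) :: p) else l u].

(* The vertex extracted is any queued one with lexicographically minimal label,
   so that every tie-breaking rule is covered. *)
Inductive dijkstra_state (R : realType) (d : nat) (V : finType)
    (A : {set V * V}) (c : V * V -> 'rV[R]_d) (t : V) (sigma : 'S_d) :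
    {set V} -> labelling V -> Prop :=
| DijkstraInit : dijkstra_state A c t sigma set0 (init_labels t)
| DijkstraStep (D : {set V}) (l : labelling V) (v : V) (p : seq (V * V)) of
    dijkstra_state A c t sigma D l
  & v \notin D
  & l v = Some p
  & (forall u q, u \notin D -> l u = Some q ->
       (lex_key sigma (cost c p) <= lex_key sigma (cost c q))%O) :
    dijkstra_state A c t sigma (v |: D) (relax A c sigma (v |: D) l v p).

(* T is a possible output: the labels when the queue has run empty. *)
Definition lex_dijkstra (R : realType) (d : nat) (V : finType)
    (A : {set V * V}) (c : V * V -> 'rV[R]_d) (t : V) (sigma : 'S_d)
    (T : labelling V) : Prop :=
  exists D : {set V},
    dijkstra_state A c t sigma D T /\ forall v, v \notin D -> T v = None.

(* The default [::] is only used for vertices from which t is unreachable. *)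
Definition tree_path (V : finType) (T : labelling V) (s : V) : seq (V * V) :=
  odflt [::] (T s).

(* With nonnegative costs and Sigma nonempty, the default 0 of the iterated
   maximum does not affect its value. *)
Definition beta_t (R : realType) (d : nat) (V : finType)
    (c : V * V -> 'rV[R]_d) (s : V) (Sigma : {set 'S_d})
    (T : 'S_d -> labelling V) (eps : R) : 'rV[R]_d :=
  \row_(i < d)
    (\big[Num.max/0]_(sigma in Sigma) cost c (tree_path (T sigma) s) 0 i + eps).

(* Main.v *)
(** Dijkstra's algorithm labels only simple paths to t, and the final set of
    labelled vertices contains t and is closed under predecessors, so each query
    returns some s-t-path. Every coordinate of its cost is at most the
    corresponding maximum, hence strictly below that of [beta_t]. A path whose
    cost is at least [beta_t] is therefore strictly dominated in all coordinates
    by the path of any single query. *)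
Require Import Defs.
From mathcomp Require Import all_boot all_order all_algebra all_fingroup.
From mathcomp Require Import reals.
Set Implicit Arguments.
Unset Strict Implicit.
Unset Printing Implicit Defensive.
Import Order.TTheory GRing.Theory Num.Theory.
Local Open Scope ring_scope.

(* The vertices of a label's path other than its start are permanently
   labelled; this is what keeps extended paths free of repeated vertices. *)
Lemma dijkstra_label_path (R : realType) (d : nat) (V : finType)
    (A : {set V * V}) (c : V * V -> 'rV[R]_d) (t : V) (sigma : 'S_d)
    (D : {set V}) (l : labelling V) :
  dijkstra_state A c t sigma D l ->
  forall u q, l u = Some q ->
    st_path A u t q /\ {subset unzip2 q <= D}.
Proof.
elim=> [|{}D {}l v p _ IH vD lv _] u q; rewrite ffunE.
  by case: eqP => // -> [<-]; rewrite /st_path /= eqxx.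
have [/and3P[uD uvA _] [<-]|_ luq] := ifP; last first.
  by have [? sub] := IH _ _ luq; split=> // x /sub xD; rewrite !inE xD orbT.
have [/and4P[pA /eqP pE plast puniq] sub] := IH _ _ lv.
have subD : {subset v :: unzip2 p <= v |: D}.
  by move=> x; rewrite !inE => /orP[->//|/sub ->]; rewrite orbT.
split=> //; apply/and4P; split; first by rewrite /= uvA.
- by rewrite /= pE.
- exact: plast.
- by rewrite cons_uniq puniq andbT (contra (subD u)).
Qed.

(** Relaxation never erases a label. When [v] becomes permanent, the tail [u] of an arc [(u, v)] is
    either already permanent, hence labelled, or labelled by this relaxation at the latest. *)
Lemma dijkstra_labelled (R : realType) (d : nat) (V : finType)
    (A : {set V * V}) (c : V * V -> 'rV[R]_d) (t : V) (sigma : 'S_d)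
    (D : {set V}) (l : labelling V) :
  dijkstra_state A c t sigma D l ->
  [/\ l t, forall u v, v \in D -> (u, v) \in A -> l u & forall v, v \in D -> l v].
Proof.
elim=> [|{}D {}l v p _ [lt lA lD] vD lv _].
  by split=> [|u v|v]; rewrite ?ffunE ?eqxx // inE.
have relax_some u : l u -> relax A c sigma (v |: D) l v p u.
  by rewrite ffunE; case: ifP.
have some_D w : w \in v |: D -> l w.
  by rewrite !inE => /orP[/eqP ->|/lD //]; rewrite lv.
split=> [|u w|w /some_D]; [exact: relax_some| |exact: relax_some].
rewrite in_setU1 => /orP[/eqP -> uvA|wD uwA]; last exact/relax_some/(lA u w).
have [uD|uD] := boolP (u \in v |: D); first exact/relax_some/some_D.
(* A candidate can fail [lex_improves] only against an existing label. *)
by rewrite ffunE uD uvA /=; case: ifP => //; case: (l u).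
Qed.

(** Once the queue is empty, every labelled vertex is permanent, so labels spread backwards from [t]
    along the arcs of a path. *)
Lemma lex_dijkstra_reachable (R : realType) (d : nat) (V : finType)
    (A : {set V * V}) (c : V * V -> 'rV[R]_d) (s t : V) (sigma : 'S_d)
    (T : labelling V) :
  lex_dijkstra A c t sigma T -> connect (fun u v => (u, v) \in A) s t -> T s.
Proof.
move=> [D [DT TD]] /connectP[p]; have [Tt TA _] := dijkstra_labelled DT.
elim: p s => [|v p IH] u /= => [_ <- //|/andP[uvA /IH{}IH] /IH Tv].
by apply: TA uvA; apply: contraLR Tv => /TD ->.
Qed.

Lemma tree_path_st_path (R : realType) (d : nat) (V : finType)
    (A : {set V * V}) (c : V * V -> 'rV[R]_d) (s t : V) (sigma : 'S_d)
    (T : labelling V) :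
  lex_dijkstra A c t sigma T -> connect (fun u v => (u, v) \in A) s t ->
  st_path A s t (tree_path T s).
Proof.
move=> DT st; have := lex_dijkstra_reachable DT st.
rewrite /tree_path; case Ts: (T s) => [q|//] _.
by have [D [/dijkstra_label_path/(_ _ _ Ts)[]]] := DT.
Qed.

Lemma cost_lt_beta_t (R : realType) (d : nat) (V : finType)
    (c : V * V -> 'rV[R]_d) (s : V) (Sigma : {set 'S_d})
    (T : 'S_d -> labelling V) (eps : R) (sigma : 'S_d) (i : 'I_d) :
  0 < eps -> sigma \in Sigma ->
  cost c (tree_path (T sigma) s) 0 i < beta_t c s Sigma T eps 0 i.
Proof.
move=> eps_gt0 sigmaS; rewrite mxE ltr_pwDr //.
exact: (le_bigmax_cond _ (fun tau => cost c (tree_path (T tau) s) 0 i)).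
Qed.

Theorem theorem3 (R : realType) (d : nat) (d_gt0 : (0 < d)%N)
    (V : finType) (A : {set V * V}) (c : V * V -> 'rV[R]_d) (s t : V)
    (Sigma : {set 'S_d}) (T : 'S_d -> labelling V) (eps : R)
    (c_ge0 : forall a, a \in A -> forall i, 0 <= c a 0 i)
    (t_reachable : connect (fun u v => (u, v) \in A) s t)
    (Sigma_orders : preprocessing_orders d_gt0 Sigma)
    (T_query : forall sigma, sigma \in Sigma ->
       lex_dijkstra A c t sigma (T sigma))
    (eps_gt0 : 0 < eps) :
  dominance_bound A c s t (beta_t c s Sigma T eps).
Proof.
move=> [p [[_ p_eff] beta_le]].
(* [d_gt0] supplies a coordinate; the order starting with it gives the query whose path dominates
   [p]. *)
have [sigma [[sigmaS _] _]] := Sigma_orders.2 (Ordinal d_gt0).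
have lt_p i : cost c (tree_path (T sigma) s) 0 i < cost c p 0 i.
  by apply: lt_le_trans (beta_le i); apply: cost_lt_beta_t.
apply: p_eff; exists (tree_path (T sigma) s); split=> [|i|].
- exact: tree_path_st_path (T_query _ sigmaS) t_reachable.
- exact: ltW.
- by exists (Ordinal d_gt0).
Qed.
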